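(* Let $n\ge2$ and $\alpha\in[0,1)$ with $\alpha\le1/n$. For $x,y>0$ put $Q_\alpha=Q_\alpha(x,y)=e^{\mathrm{i}\pi\alpha/2}x+e^{-\mathrm{i}\pi\alpha/2}y$ and $$F^\alpha_{n,0}(x,y)=\sum_{A\in\mathcal A_n,\ \mu(A)=0}Q_\alpha^{2\nu(A)}\,\overline{Q_\alpha}^{\,n(n-1)-2\nu(A)}.$$ Then $F^\alpha_{n,0}(x,y)>0$ for all $x,y>0$.
   Context: $\mathcal A_n$ is the set of $n\times n$ alternating sign matrices: matrices with entries in $\{0,1,-1\}$ such that every row and every column sums to $1$ and the nonzero entries in each row and each column alternate in sign. For $A=(A_{ij})\in\mathcal A_n$, $\mu(A)$ is the number of entries equal to $-1$, and $\nu(A)=\sum_{1\le i<i'\le n,\ 1\le j<j'\le n}A_{ij}A_{i'j'}$. (Matrices with $\mu(A)=0$ are exactly the $n\times n$ permutation matrices.) *)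

(* Defs.v *)
From HB Require Import structures.
From mathcomp Require Import all_boot all_order all_algebra.
From mathcomp Require Import reals trigo.
From mathcomp Require Import complex.
Set Implicit Arguments. Unset Strict Implicit. Unset Printing Implicit Defensive.
Import Order.TTheory GRing.Theory Num.Theory.
Local Open Scope ring_scope.

Section ASM.
Variable n : nat.

Definition alternating (s : seq int) : bool :=
  sorted (fun a b => a * b == -1) [seq a <- s | a != 0].

Definition row_seq (A : 'M[int]_n) (i : 'I_n) : seq int := [seq A i j | j <- enum 'I_n].
Definition col_seq (A : 'M[int]_n) (j : 'I_n) : seq int := [seq A i j | i <- enum 'I_n].

Definition is_asm (A : 'M[int]_n) : bool :=
  [&& [forall i, forall j, A i j \in [:: 0; 1; -1]],
      [forall i, \sum_(j < n) A i j == 1],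
      [forall j, \sum_(i < n) A i j == 1],
      [forall i, alternating (row_seq A i)] &
      [forall j, alternating (col_seq A j)]].

Definition mu (A : 'M[int]_n) : nat :=
  #|[set ij : 'I_n * 'I_n | A ij.1 ij.2 == -1]|.

Definition nu (A : 'M[int]_n) : int :=
  \sum_(i < n) \sum_(i' < n | (i < i')%N) \sum_(j < n) \sum_(j' < n | (j < j')%N)
     A i j * A i' j'.

(* encoding of {0,1,-1}-valued matrices by a finite type, to sum over A_n *)
Definition sign_of (k : 'I_3) : int :=
  match val k with 0%N => 0 | 1%N => 1 | _ => -1 end.
Definition mx_of (B : 'M['I_3]_n) : 'M[int]_n := map_mx sign_of B.

End ASM.

Definition expi (R : realType) (t : R) : R[i] := (cos t +i* sin t)%C.

Definition Qa (R : realType) (alpha x y : R) : R[i] :=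
  expi (pi * alpha / 2) * (x%:C)%C + expi (- (pi * alpha / 2)) * (y%:C)%C.

(* F^alpha_{n,0}(x,y): the sum over A in A_n with mu(A) = 0; every A in A_n is
   mx_of B for exactly one B (sign_of is injective), so summing over B is summing over A_n. *)
Definition F0 (R : realType) (n : nat) (alpha x y : R) : R[i] :=
  \sum_(B : 'M['I_3]_n | is_asm (mx_of B) && (mu (mx_of B) == 0%N))
     Qa alpha x y ^ (2 * nu (mx_of B)) *
     (Qa alpha x y)^* ^ ((n * (n - 1))%N%:Z - 2 * nu (mx_of B)).

(* Main.v *)
Require Import Defs.
From HB Require Import structures.
From mathcomp Require Import all_boot all_order all_algebra all_fingroup.
From mathcomp Require Import reals trigo.
From mathcomp Require Import complex.
From mathcomp Require Import ring lra zify.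
Set Implicit Arguments.
Unset Strict Implicit.
Unset Printing Implicit Defensive.

Import Order.TTheory GRing.Theory Num.Theory.
Local Open Scope ring_scope.

(* Restricted to permutation matrices, nu counts the non-inversions of the
   permutation, whose generating function is the q-factorial: summing over
   S_n gives, with w = Q^2 / conj(Q)^2, the factorisation
     F = prod_{k < n} conj(Q)^(2k) (1 + w + ... + w^k).
   Writing Q = rho e^(i th), where |th| < pi alpha / 2 since Re Q > 0 and
   |Im Q| < tan(pi alpha / 2) Re Q, the k-th factor is rho^(2k) times
   sum_{j <= k} cos(2 th (2j - k)) = sin(2 th (k + 1)) / sin(2 th), which is
   positive because 2 |th| n < pi alpha n <= pi. *)

Section Trigonometry.
Variable R : realType.
Implicit Types (a b psi : R) (k : nat).

Lemma expiD a b : expi a * expi b = expi (a + b).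
Proof. by rewrite /expi; simpc; rewrite cosD sinD; congr Complex; ring. Qed.

Lemma expi0 : expi (0 : R) = 1.
Proof. by rewrite /expi cos0 sin0. Qed.

Lemma expiMn a m : expi a ^+ m = expi (a *+ m).
Proof.
elim: m => [|m IHm]; first by rewrite mulr0n expi0.
by rewrite exprS IHm expiD mulrS.
Qed.

Lemma big_Complex (I : Type) (r : seq I) (P : pred I) (f g : I -> R) :
  \sum_(i <- r | P i) (f i +i* g i)%C =
  ((\sum_(i <- r | P i) f i) +i* (\sum_(i <- r | P i) g i))%C.
Proof.
elim: r => [|i r IHr]; first by rewrite !big_nil.
by rewrite !big_cons IHr; case: (P i) => //; simpc.
Qed.

Definition sym_cos_sum psi k := \sum_(j < k.+1) cos (psi * (j%:R *+ 2 - k%:R)).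
Definition sym_sin_sum psi k := \sum_(j < k.+1) sin (psi * (j%:R *+ 2 - k%:R)).

Lemma sym_sin_sum_eq0 psi k : sym_sin_sum psi k = 0.
Proof.
suff : sym_sin_sum psi k = - sym_sin_sum psi k by lra.
rewrite {1}/sym_sin_sum (reindex_inj rev_ord_inj) -sumrN.
apply: eq_bigr => j _; rewrite -sinN /= natrB // -!natr1; congr sin; ring.
Qed.

Lemma sin_mul_sym_cos_sum psi k :
  sin psi * sym_cos_sum psi k = sin (psi * k.+1%:R).
Proof.
pose f (j : nat) := sin (psi * (j%:R *+ 2 - k.+1%:R)).
have step j : sin psi * cos (psi * (j%:R *+ 2 - k%:R)) = (f j.+1 - f j) / 2.
  rewrite /f -!natr1.
  have -> : psi * ((j%:R + 1) *+ 2 - (k%:R + 1)) = psi * (j%:R *+ 2 - k%:R) + psi.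
    by ring.
  have -> : psi * (j%:R *+ 2 - (k%:R + 1)) = psi * (j%:R *+ 2 - k%:R) - psi.
    by ring.
  by rewrite sinD sinB; field.
rewrite /sym_cos_sum mulr_sumr (eq_bigr (fun j : 'I_k.+1 => (f j.+1 - f j) / 2));
  last by move=> j _; apply: step.
rewrite -mulr_suml.
rewrite -(big_mkord xpredT (fun j => f j.+1 - f j)) telescope_sumr //.
rewrite /f mul0rn sub0r mulrN sinN.
have -> : psi * (k.+1%:R *+ 2 - k.+1%:R) = psi * k.+1%:R by ring.
by field.
Qed.

Lemma sym_cos_sum_gt0 psi k : `|psi| * k.+1%:R < pi -> 0 < sym_cos_sum psi k.
Proof.
wlog psi_ge0 : psi / 0 <= psi.
  move=> ge0P; have [/ge0P//|psi_lt0] := leP 0 psi.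
  rewrite -normrN; have -> : sym_cos_sum psi k = sym_cos_sum (- psi) k.
    by apply: eq_bigr => j _; rewrite mulNr cosN.
  by apply: ge0P; lra.
rewrite ger0_norm // => lt_pi.
move: psi_ge0; rewrite le_eqVlt => /predU1P[psi0|psi_gt0].
  rewrite /sym_cos_sum -psi0 (eq_bigr (fun=> 1)) => [|j _]; last by rewrite mul0r cos0.
  by rewrite sumr_const card_ord ltr0n.
have sin_psi_gt0 : 0 < sin psi.
  apply: sin_gt0_pi; rewrite psi_gt0 /=.
  by apply: le_lt_trans lt_pi; rewrite ler_peMr ?ler1n // ltW.
rewrite -(pmulr_rgt0 _ sin_psi_gt0) sin_mul_sym_cos_sum.
by apply: sin_gt0_pi; rewrite lt_pi mulr_gt0 // ltr0n.
Qed.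

Lemma sum_expi_sym psi k :
  \sum_(j < k.+1) expi (psi * (j%:R *+ 2 - k%:R)) = (sym_cos_sum psi k)%:C%C.
Proof. by rewrite big_Complex -/(sym_cos_sum _ _) -/(sym_sin_sum _ _) sym_sin_sum_eq0. Qed.

End Trigonometry.

Section PolarForm.
Variable R : realType.
Implicit Types (a b t phi x y : R).

Lemma expi_combination phi x y :
  expi phi * x%:C%C + expi (- phi) * y%:C%C = ((x + y) * cos phi +i* ((x - y) * sin phi))%C.
Proof. by rewrite /expi cosN sinN -!complexr0; simpc; congr Complex; ring. Qed.

Lemma polar_re_gt0 a b : 0 < a ->
  let th := atan (b / a) in
  [/\ 0 < a / cos th & (a +i* b)%C = ((a / cos th)%:C * expi th)%C].
Proof.
move=> a_gt0 th; have cos_gt0 : 0 < cos th.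
  by apply: cos_gt0_pihalf; rewrite atan_gtNpi2 atan_ltpi2.
have sin_th : sin th = b / a * cos th.
  by rewrite -[in RHS](atanK (b / a)) /tan divfK // gt_eqF.
split; first exact: divr_gt0.
rewrite /expi -!complexr0; simpc; rewrite sin_th.
by congr Complex; field; rewrite !gt_eqF.
Qed.

Lemma abs_atan_lt phi t : 0 < phi < pi / 2 -> `|t| < tan phi -> `|atan t| < phi.
Proof.
case/andP=> phi_gt0 phi_lt; rewrite !ltr_norml => /andP[lt_t t_lt].
have atan_tan : atan (tan phi) = phi.
  rewrite tanK // in_itv /= phi_lt andbT; apply: lt_trans phi_gt0.
  by rewrite oppr_lt0 divr_gt0 ?pi_gt0.
apply/andP; split.
  by rewrite -{1}atan_tan -atanN lt_atan.
by rewrite -atan_tan lt_atan.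
Qed.

Lemma Qa_polar alpha x y : 0 <= alpha -> alpha < 1 -> 0 < x -> 0 < y ->
  exists rho th, [/\ 0 < rho, Qa alpha x y = (rho%:C * expi th)%C &
                     th = 0 \/ `|th| < pi * alpha / 2].
Proof.
move=> alpha_ge0 alpha_lt1 x_gt0 y_gt0.
set phi := pi * alpha / 2.
have phi_lt : phi < pi / 2.
  by rewrite /phi ltr_pM2r ?invr_gt0 // gtr_pMr ?pi_gt0.
have cos_gt0 : 0 < cos phi.
  apply: cos_gt0_pihalf; rewrite phi_lt andbT; apply: lt_le_trans (_ : 0 <= phi).
    by rewrite oppr_lt0 divr_gt0 ?pi_gt0.
  by rewrite /phi divr_ge0 // mulr_ge0 // ltW ?pi_gt0.
have re_gt0 : 0 < (x + y) * cos phi by rewrite mulr_gt0 ?addr_gt0.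
have [] := polar_re_gt0 ((x - y) * sin phi) re_gt0.
set th := atan _ => rho_gt0 polar.
exists ((x + y) * cos phi / cos th), th.
split => //; first by rewrite /Qa expi_combination -/phi polar.
have [alpha0|alpha_gt0] := eqVneq alpha 0.
  by left; rewrite /th /phi alpha0 mulr0 mul0r sin0 mulr0 mul0r atan0.
have phi_gt0 : 0 < phi.
  by rewrite /phi !mulr_gt0 ?pi_gt0 ?invr_gt0 // lt_neqAle eq_sym alpha_gt0.
have tan_gt0 : 0 < tan phi.
  by rewrite /tan divr_gt0 // sin_gt0_pihalf // phi_gt0.
right; apply: abs_atan_lt; first by rewrite phi_gt0.
rewrite /th.
have -> : (x - y) * sin phi / ((x + y) * cos phi) = (x - y) / (x + y) * tan phi.
  by rewrite /tan; field; rewrite !gt_eqF ?addr_gt0.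
rewrite normrM (gtr0_norm tan_gt0) gtr_pMl // ltr_norml.
by rewrite ltr_pdivrMr ?ltr_pdivlMr ?addr_gt0 // mul1r mulN1r; apply/andP; split; lra.
Qed.

End PolarForm.

Definition noninv n (s : 'S_n) : nat :=
  \sum_(i < n) \sum_(i' < n | (i < i')%N) (s i < s i')%N.

Lemma sum_perm_lift (V : nmodType) n (f : 'S_n.+1 -> V) :
  \sum_(s : 'S_n.+1) f s = \sum_(j : 'I_n.+1) \sum_(s : 'S_n) f (lift_perm ord_max j s).
Proof.
rewrite (partition_big (fun s : 'S_n.+1 => s ord_max) xpredT) //=.
apply: eq_bigr => j0 _.
pose i0 : 'I_n.+1 := ord_max.
rewrite (reindex (lift_perm i0 j0)); last first.
  pose ulsf i (s : 'S_n.+1) k := odflt k (unlift (s i) (s (lift i k))).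
  have ulsfK i (s : 'S_n.+1) k: lift (s i) (ulsf i s k) = s (lift i k).
    rewrite /ulsf; have:= neq_lift i k.
    by rewrite -(can_eq (permK s)) => /unlift_some[] ? ? ->.
  have inj_ulsf: injective (ulsf i0 _).
    move=> s; apply: can_inj (ulsf (s i0) s^-1%g) _ => k'.
    by rewrite {1}/ulsf ulsfK !permK liftK.
  exists (fun s => perm (inj_ulsf s)) => [s _ | s].
    by apply/permP=> k'; rewrite permE /ulsf lift_perm_lift lift_perm_id liftK.
  move/(s _ =P _) => si0; apply/permP=> k.
  case: (unliftP i0 k) => [k'|] ->; rewrite ?lift_perm_id //.
  by rewrite lift_perm_lift -si0 permE ulsfK.
by apply: eq_bigl => s; rewrite lift_perm_id eqxx.
Qed.

Lemma lift_ord_max n (i : 'I_n) : lift ord_max i = widen_ord (leqnSn n) i.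
Proof. exact/val_inj/lift_max. Qed.

Lemma ltn_lift n (h : 'I_n.+1) (i j : 'I_n) : (lift h i < lift h j)%N = (i < j)%N.
Proof. by rewrite /= /bump; case: leqP; case: leqP; lia. Qed.

Lemma ltn_lift_pivot n (h : 'I_n.+1) (i : 'I_n) : (lift h i < h)%N = (i < h)%N.
Proof. by rewrite /= /bump; case: leqP; lia. Qed.

Lemma sum_perm_ltn n (s : 'S_n) (m : nat) : (m <= n)%N ->
  (\sum_(i < n) (s i < m)%N)%N = m.
Proof.
move=> le_mn; rewrite (reindex_inj (@perm_inj _ s^-1)) /=.
rewrite (eq_bigr (fun i : 'I_n => (i < m)%N : nat)) => [|i _]; last by rewrite permKV.
rewrite -(big_mkord xpredT (fun i => (i < m)%N : nat)) (@big_cat_nat _ _ _ m) //=.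
rewrite (eq_big_nat _ _ (F2 := fun _ => 1%N)) => [|i /andP[_ ->]] //.
rewrite [X in (_ + X)%N](eq_big_nat _ _ (F2 := fun _ => 0%N)) => [|i /andP[le_mi _]].
  by rewrite !sum_nat_const_nat; lia.
by rewrite ltnNge le_mi.
Qed.

Lemma noninv_lift_max n (j : 'I_n.+1) (s : 'S_n) :
  noninv (lift_perm ord_max j s) = (noninv s + j)%N.
Proof.
rewrite /noninv big_ord_recr /= [X in (_ + X)%N]big_pred0 => [|i]; last first.
  by rewrite ltnNge -ltnS ltn_ord.
rewrite addn0 -(sum_perm_ltn s (ltn_ord j)) -big_split /=.
apply: eq_bigr => i _.
rewrite big_mkcond big_ord_recr /= -big_mkcond /= ltn_ord -!lift_ord_max.
rewrite lift_perm_id !lift_perm_lift ltn_lift_pivot; congr (_ + _)%N.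
by apply: eq_bigr => i' _; rewrite -!lift_ord_max !lift_perm_lift ltn_lift.
Qed.

Lemma sum_ltn_pairs n : (\sum_(i < n) \sum_(i' < n | (i < i')%N) 1)%N = 'C(n, 2).
Proof.
elim: n => [|n IHn]; first by rewrite big_ord0.
rewrite big_ord_recr /= [X in (_ + X)%N]big_pred0 => [|i']; last first.
  by rewrite ltnNge -ltnS ltn_ord.
rewrite binS bin1 addn0 -IHn -[X in (_ + X)%N]card_ord -sum1_card -big_split /=.
apply: eq_bigr => i _; rewrite big_mkcond big_ord_recr /= -big_mkcond /= ltn_ord.
by congr (_ + _)%N; apply: eq_bigr.
Qed.

Lemma noninv_le_bin2 n (s : 'S_n) : (noninv s <= 'C(n, 2))%N.
Proof.
by rewrite -sum_ltn_pairs; apply: leq_sum => i _; apply: leq_sum => i' _; case: ltnP.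
Qed.

Lemma sum_perm_noninv (R : comPzSemiRingType) n (u v : R) :
  \sum_(s : 'S_n) u ^+ noninv s * v ^+ ('C(n, 2) - noninv s) =
  \prod_(k < n) \sum_(j < k.+1) u ^+ j * v ^+ (k - j).
Proof.
elim: n => [|n IHn].
  rewrite big_ord0 (big_pred1 1%g) => [|s]; last by symmetry; apply/eqP/permP => -[].
  by rewrite /noninv big_ord0 mulr1.
rewrite sum_perm_lift [in RHS]big_ord_recr /= -IHn mulrC mulr_suml.
apply: eq_bigr => j _.
rewrite mulr_sumr; apply: eq_bigr => s _; rewrite noninv_lift_max binS bin1.
have le_jn : (j <= n)%N by rewrite -ltnS.
have := noninv_le_bin2 s; set m := noninv s => le_m.
have -> : ('C(n, 2) + n - (m + j) = ('C(n, 2) - m) + (n - j))%N by lia.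
by rewrite !exprD mulrACA mulrC.
Qed.

Definition perm_code n (s : 'S_n) : 'M['I_3]_n :=
  \matrix_(i, j) (if s i == j then Ordinal (isT : (1 < 3)%N) else ord0).

Lemma mx_of_perm_code n (s : 'S_n) i j : mx_of (perm_code s) i j = (s i == j)%:Z.
Proof. by rewrite /mx_of !mxE; case: (s i == j). Qed.

Lemma sign_of_inj : injective sign_of.
Proof. by move=> [[|[|[|a]]] ?] [[|[|[|b]]] ?] //= _; apply: val_inj. Qed.

Lemma perm_code_inj n : injective (@perm_code n).
Proof.
move=> s1 s2 eq12; apply/permP => i; apply/eqP.
move/matrixP/(_ i (s1 i)): eq12; rewrite !mxE eqxx eq_sym.
by case: eqP => // _ /(congr1 val).
Qed.

Lemma sum_eqz_mul n (a : 'I_n) (g : 'I_n -> int) : \sum_(j < n) (a == j)%:Z * g j = g a.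
Proof.
rewrite (bigD1 a) //= eqxx mul1r big1 ?addr0 // => j /negbTE.
by rewrite eq_sym => ->; rewrite mul0r.
Qed.

Lemma filter_eqz_neq0 n (a : 'I_n) :
  [seq z <- [seq (a == j)%:Z | j <- enum 'I_n] | z != 0] = [:: 1].
Proof.
rewrite filter_map (eq_filter (a2 := pred1 a)) => [|j /=].
  by rewrite filter_pred1_uniq ?enum_uniq ?mem_enum //= eqxx.
by rewrite [j == a]eq_sym; case: (a == j).
Qed.

Lemma perm_code_asm n (s : 'S_n) :
  is_asm (mx_of (perm_code s)) && (mu (mx_of (perm_code s)) == 0%N).
Proof.
have col_code j i : mx_of (perm_code s) i j = (s^-1%g j == i)%:Z.
  by rewrite mx_of_perm_code (canF_eq (permK s)) eq_sym.
have sum_eqz1 (a : 'I_n) : \sum_(j < n) (a == j)%:Z = 1.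
  by rewrite -[RHS](sum_eqz_mul a (fun=> 1)); apply: eq_bigr => j _; rewrite mulr1.
apply/andP; split; last first.
  by rewrite /mu cards_eq0; apply/eqP/setP => ij; rewrite !inE mx_of_perm_code; case: eqP.
apply/and5P; split; apply/forallP => i.
- by apply/forallP => j; rewrite mx_of_perm_code; case: eqP.
- by rewrite (eq_bigr _ (fun j _ => mx_of_perm_code s i j)) sum_eqz1.
- by rewrite (eq_bigr _ (fun j _ => col_code i j)) sum_eqz1.
- by rewrite /Defs.alternating /row_seq (eq_map (mx_of_perm_code s i)) filter_eqz_neq0.
- by rewrite /Defs.alternating /col_seq (eq_map (col_code i)) filter_eqz_neq0.
Qed.

Lemma indicator_of_sum1 n (F : 'I_n -> int) :
  (forall k, (F k == 0) || (F k == 1)) -> \sum_k F k = 1 ->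
  exists a, forall k, F k = (a == k)%:Z.
Proof.
move=> F01 sumF; have [a /eqP Fa1|F_neq1] := pickP (fun k => F k == 1); last first.
  by move: sumF; rewrite big1 // => k _; have := F01 k; rewrite F_neq1 orbF => /eqP.
exists a => k; have [<-|neq_ak] := eqVneq a k; first by rewrite Fa1.
have F_ge0 j : 0 <= F j by case/orP: (F01 j) => /eqP ->.
move: sumF; rewrite (bigD1 a) //= (bigD1 k) 1?eq_sym //= Fa1.
set S := (X in 1 + (_ + X)); have : 0 <= S by apply: sumr_ge0.
by case/orP: (F01 k) => /eqP ->; lia.
Qed.

Lemma asm_mu0_perm_code n (B : 'M['I_3]_n) :
  is_asm (mx_of B) && (mu (mx_of B) == 0%N) -> exists s, B = perm_code s.
Proof.
set A := mx_of B; case/andP => /and5P[/forallP entries rows cols _ _] mu0.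
have A01 i j : (A i j == 0) || (A i j == 1).
  have : A i j != -1.
    by move: mu0; rewrite /mu cards_eq0 => /eqP/setP/(_ (i, j)); rewrite !inE => ->.
  by move/forallP: (entries i) => /(_ j); rewrite !inE; case/or3P => /eqP ->.
have /fin_all_exists[f rowA] : forall i, exists a, forall j, A i j = (a == j)%:Z.
  move=> i; apply: indicator_of_sum1 => [j|]; first exact: A01.
  exact/eqP/(forallP rows).
have /fin_all_exists[g colA] : forall j, exists a, forall i, A i j = (a == i)%:Z.
  move=> j; apply: indicator_of_sum1 => [i|]; first exact: A01.
  exact/eqP/(forallP cols).
have fK : cancel f g by move=> i; have := colA (f i) i; rewrite rowA eqxx; case: eqP.
exists (perm (can_inj fK)); apply/matrixP => i j; apply: sign_of_inj.
have -> : sign_of (B i j) = A i j by rewrite /A /mx_of mxE.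
by rewrite rowA !mxE permE; case: eqP.
Qed.

Lemma nu_perm_code n (s : 'S_n) : nu (mx_of (perm_code s)) = (noninv s)%:Z.
Proof.
rewrite /nu /noninv (big_morph Posz PoszD (erefl 0%:Z)); apply: eq_bigr => i _.
rewrite (big_morph Posz PoszD (erefl 0%:Z)); apply: eq_bigr => i' _.
rewrite (eq_bigr (fun j => (s i == j)%:Z * \sum_(j' < n | (j < j')%N) (s i' == j')%:Z));
  last by move=> j _; rewrite mulr_sumr; apply: eq_bigr => j' _; rewrite !mx_of_perm_code.
rewrite (sum_eqz_mul (s i) (fun j => \sum_(j' < n | (j < j')%N) (s i' == j')%:Z)).
rewrite big_mkcond (bigD1 (s i')) //= eqxx big1 ?addr0; first by case: ltnP.
by move=> j /negbTE; rewrite eq_sym => ->; case: ltnP.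
Qed.

Lemma sum_asm_mu0 (V : nmodType) n (phi : int -> V) :
  \sum_(B : 'M['I_3]_n | is_asm (mx_of B) && (mu (mx_of B) == 0%N)) phi (nu (mx_of B)) =
  \sum_(s : 'S_n) phi (noninv s)%:Z.
Proof.
rewrite (eq_bigl [in [set perm_code s | s : 'S_n]]) => [|B]; last first.
  apply/idP/imsetP => [/asm_mu0_perm_code[s ->]|[s _ ->]]; last exact: perm_code_asm.
  by exists s.
rewrite big_imset /=; last exact: in2W (@perm_code_inj n).
by apply: eq_bigr => s _; rewrite nu_perm_code.
Qed.

Lemma mul_pred_bin2 n : (n * (n - 1) = 'C(n, 2) * 2)%N.
Proof. by rewrite (bin_ffact n 2) ffactnS ffactn1 subn1. Qed.

Lemma exprz_bin2_split (R : unitRingType) n m (z w : R) : (m <= 'C(n, 2))%N ->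
  z ^ (2 * m%:Z) * w ^ ((n * (n - 1))%N%:Z - 2 * m%:Z) =
  (z ^+ 2) ^+ m * (w ^+ 2) ^+ ('C(n, 2) - m).
Proof.
move=> le_m; rewrite mul_pred_bin2.
have -> : ('C(n, 2) * 2)%N%:Z - 2 * m%:Z = (2 * ('C(n, 2) - m))%N%:Z by lia.
by rewrite -PoszM -!exprnP -!exprM.
Qed.

Lemma F0_prod (R : realType) n (alpha x y : R) :
  let Q := Qa alpha x y in
  F0 n alpha x y = \prod_(k < n) \sum_(j < k.+1) (Q ^+ 2) ^+ j * ((Q^*)%C ^+ 2) ^+ (k - j).
Proof.
move=> Q; pose phi (m : int) := Q ^ (2 * m) * Q^*%C ^ ((n * (n - 1))%N%:Z - 2 * m).
rewrite -sum_perm_noninv; transitivity (\sum_(s : 'S_n) phi (noninv s)%:Z).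
  exact: sum_asm_mu0 n phi.
by apply: eq_bigr => s _; rewrite /phi exprz_bin2_split ?noninv_le_bin2.
Qed.

Section Positivity.
Variable R : realType.

Lemma sum_polar_factor (rho th : R) k :
  let Q := (rho%:C * expi th)%C in
  \sum_(j < k.+1) (Q ^+ 2) ^+ j * ((Q^*)%C ^+ 2) ^+ (k - j) =
  ((rho ^+ (2 * k))%:C * (sym_cos_sum (th *+ 2) k)%:C)%C.
Proof.
move=> Q; have conjQ : Q^*%C = (rho%:C * expi (- th))%C.
  by rewrite /Q /expi cosN sinN -!complexr0; simpc.
rewrite conjQ -sum_expi_sym mulr_sumr; apply: eq_bigr => j _.
have le_jk : (j <= k)%N by rewrite -ltnS.
rewrite /Q -!exprM !exprMn !expiMn mulrACA -exprD -mulnDr subnKC // expiD -rmorphXn.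
have -> : th *+ (2 * j) + - th *+ (2 * (k - j)) = th *+ 2 * (j%:R *+ 2 - k%:R).
  rewrite -[th *+ (2 * j)]mulr_natr -[- th *+ _]mulr_natr -[th *+ 2]mulr_natr.
  by rewrite -[j%:R *+ 2]mulr_natr !natrM natrB //; ring.
reflexivity.
Qed.

Lemma double_arg_bound (alpha th : R) n k : (k < n)%N -> alpha <= n%:R^-1 ->
  th = 0 \/ `|th| < pi * alpha / 2 -> `|th *+ 2| * k.+1%:R < pi.
Proof.
move=> lt_kn alpha_le [->|th_lt]; first by rewrite mul0rn normr0 mul0r pi_gt0.
have n_gt0 : (0 : R) < n%:R by rewrite ltr0n (leq_trans _ lt_kn).
have k_le_n : (k.+1%:R : R) <= n%:R by rewrite ler_nat.
have alpha_n : alpha * n%:R <= 1 by rewrite -ler_pdivlMr // div1r.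
have := normr_ge0 th; have := @pi_gt0 R; rewrite normrMn; nra.
Qed.

End Positivity.

Theorem proposition3 (R : realType) (n : nat) (alpha : R) :
  (2 <= n)%N -> 0 <= alpha -> alpha < 1 -> alpha <= n%:R^-1 ->
  forall x y : R, 0 < x -> 0 < y -> 0 < F0 n alpha x y.
Proof.
move=> _ alpha_ge0 alpha_lt1 alpha_le x y x_gt0 y_gt0.
have [rho [th [rho_gt0 Qpolar th_small]]] := Qa_polar alpha_ge0 alpha_lt1 x_gt0 y_gt0.
rewrite F0_prod Qpolar; apply: prodr_gt0 => k _.
rewrite sum_polar_factor -rmorphM ltcE /= eqxx mulr_gt0 ?exprn_gt0 //.
exact/sym_cos_sum_gt0/(double_arg_bound (ltn_ord k) alpha_le).
Qed.
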